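(* Let $\gamma: I\to S^n(1)$ be a curve in the $n$-dimensional unit sphere, parametrized by its arclength, with Frenet curvatures $k_1,k_2,k_3,\dots$, and let $f:I\to(0,\infty)$ be a smooth function. Then $\gamma$ is a bi-$f$-harmonic curve if and only if $$\left\{\begin{array}{l} -3k_1k_1'f^2-4k_1^2ff'+ff'''+f'f''=0,\\ -k_1^3f^2-k_1k_2^2f^2+k_1''f^2+k_1f^2+4k_1'ff'+3k_1ff''+2k_1(f')^2=0,\\ 2k_1'k_2f+k_1k_2'f+4k_1k_2f'=0,\\ k_1k_2k_3=0. \end{array}\right.$$
   Context: $I\subset\mathbb{R}$ is an open interval, and $\gamma:I\to (N,h)$ is a smooth curve parametrized by arclength in an $n$-dimensional Riemannian manifold (here $N=S^n(1)$, of constant sectional curvature $1$), with unit tangent $T=\gamma'$; $\nabla^N$ is the Levi-Civita connection and $R^N(X,Y)=[\nabla_X,\nabla_Y]-\nabla_{[X,Y]}$ is the curvature operator. For a smooth function $f:I\to(0,\infty)$, the $f$-tension field of $\gamma$ is $\tau_f(\gamma)=f\,\nabla^N_TT+f'T$. The curve $\gamma$ is called bi-$f$-harmonic if it is a critical point of the bi-$f$-energy $\frac12\int|\tau_f(\gamma)|^2\,dt$ (over compact subdomains), i.e. if it satisfies the Euler-Lagrange equation $\nabla^N_T\big(f\,\nabla^N_T\tau_f(\gamma)\big)+f\,R^N(\tau_f(\gamma),T)T=0$. Frenet frame: $\{E_1,\dots,E_n\}$ is an orthonormal frame along $\gamma$ with $E_1=T$ satisfying $\nabla^N_TE_1=k_1E_2$,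 $\nabla^N_TE_r=-k_{r-1}E_{r-1}+k_rE_{r+1}$ for $2\le r\le n-1$, $\nabla^N_TE_n=-k_{n-1}E_{n-1}$, where $k_1=\|\nabla^N_TE_1\|$ and $k_2,\dots,k_{n-1}$ are non-negative (smooth) real functions on $I$, the curvatures of $\gamma$; curvatures $k_r$ with $r\ge n$ are read as $0$. Primes denote derivatives with respect to the arclength parameter. *)

(* Defs.v *)
From HB Require Import structures.
From mathcomp Require Import all_boot all_order all_algebra.
From mathcomp Require Import all_classical all_reals.
From mathcomp Require Import topology normedtype derive.

Set Implicit Arguments.
Unset Strict Implicit.
Unset Printing Implicit Defensive.

Import Order.TTheory GRing.Theory Num.Theory.
Import numFieldNormedType.Exports.

Local Open Scope classical_set_scope.
Local Open Scope ring_scope.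

(* Curves are total functions [R -> _] whose values off the
   open set [I] are irrelevant, as every condition is imposed at points of [I]
   and derivatives at a point of an open set only depend on the values there. *)

Definition open_interval (R : realType) (I : set R) : Prop :=
  open I /\ is_interval I.

Definition smooth_on (R : realType) (V : normedModType R) (I : set R)
    (g : R -> V) : Prop :=
  forall (m : nat) (t : R), I t -> derivable (derive1n m g) t 1.

Section Euclidean.
Context {R : realType} {m : nat}.
Implicit Types u v : 'rV[R]_m.

Definition dot u v : R := \sum_(i < m) u 0 i * v 0 i.

(* The library norm [`|u|] on matrices is the sup norm. *)
Definition enorm u : R := Num.sqrt (dot u u).

End Euclidean.

Section Sphere.
Context {R : realType} {n : nat}.

(* S^n(1) is the unit sphere of R^(n+1) with the induced metric, so tangent
   vectors at [p] are the vectors orthogonal to [p] and the Levi-Civita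
   connection is the tangential part of the Euclidean derivative. *)
Implicit Types (p x y z : 'rV[R]_n.+1) (X Y Z : 'rV[R]_n.+1 -> 'rV[R]_n.+1).

Definition sphere (p : 'rV[R]_n.+1) : Prop := dot p p = 1.

Definition tangent_part p x : 'rV[R]_n.+1 := x - dot x p *: p.

(* Vector fields on the sphere are represented by ambient fields; for [X], [Y]
   tangent to the sphere, the values of [nabla X Y] and [bracket X Y] on the
   sphere only depend on those of [X] and [Y] on the sphere. *)
Definition nabla X Y p : 'rV[R]_n.+1 := tangent_part p ('D_(X p) Y p).

Definition bracket X Y p : 'rV[R]_n.+1 := 'D_(X p) Y p - 'D_(Y p) X p.

Definition curvature X Y Z p : 'rV[R]_n.+1 :=
  nabla X (nabla Y Z) p - nabla Y (nabla X Z) p - nabla (bracket X Y) Z p.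

(* A smooth tangent field with value [x] at [p] when [x] is tangent at [p]. *)
Definition extend x : 'rV[R]_n.+1 -> 'rV[R]_n.+1 :=
  fun q => tangent_part q x.

(* [curvature] is tensorial, hence the choice of extensions is immaterial. *)
Definition curvature_at p x y z : 'rV[R]_n.+1 :=
  curvature (extend x) (extend y) (extend z) p.

Implicit Types (c V : R -> 'rV[R]_n.+1) (f : R -> R) (t : R).

(* Covariant derivative along the curve [c] of a tangent field [V] along [c]. *)
Definition cov c V t : 'rV[R]_n.+1 := tangent_part (c t) (derive1 V t).

Definition unit_speed_curve (I : set R) c : Prop :=
  [/\ smooth_on I c,
      forall t, I t -> sphere (c t)
    & forall t, I t -> enorm (derive1 c t) = 1].

Definition tension f c t : 'rV[R]_n.+1 :=
  f t *: cov c (derive1 c) t + derive1 f t *: derive1 c t.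

(* Euler-Lagrange equation of the bi-f-energy. *)
Definition bi_f_harmonic (I : set R) f c : Prop :=
  forall t, I t ->
    cov c (fun s => f s *: cov c (tension f c) s) t
    + f t *: curvature_at (c t) (tension f c t) (derive1 c t) (derive1 c t) = 0.

(* Indices start at 1: the frame is E 1, ..., E n, and the curvatures are
   k 1, ..., k (n - 1), with k r read as 0 for r >= n. *)
Record frenet_frame (I : set R) c (E : nat -> R -> 'rV[R]_n.+1)
    (k : nat -> R -> R) : Prop := FrenetFrame {
  frenet_smooth : forall r, (1 <= r <= n)%N -> smooth_on I (E r);
  frenet_tangent : forall r t, (1 <= r <= n)%N -> I t -> dot (E r t) (c t) = 0;
  frenet_orthonormal : forall r s t, (1 <= r <= n)%N -> (1 <= s <= n)%N ->
    I t -> dot (E r t) (E s t) = (r == s)%:R;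
  frenet_first : forall t, I t -> E 1%N t = derive1 c t;
  frenet_k1 : forall t, I t -> k 1%N t = enorm (cov c (E 1%N) t);
  frenet_k_smooth : forall r, (2 <= r < n)%N -> smooth_on I (k r);
  frenet_k_ge0 : forall r t, (2 <= r < n)%N -> I t -> 0 <= k r t;
  frenet_k_eq0 : forall r t, (n <= r)%N -> I t -> k r t = 0;
  frenet_eq1 : forall t, I t -> cov c (E 1%N) t = k 1%N t *: E 2%N t;
  frenet_eq : forall r t, (2 <= r < n)%N -> I t ->
    cov c (E r) t = - k r.-1 t *: E r.-1 t + k r t *: E r.+1 t;
  frenet_eqn : forall t, (2 <= n)%N -> I t ->
    cov c (E n) t = - k n.-1 t *: E n.-1 t
}.

End Sphere.

(* Main.v *)
Require Import Defs.
From HB Require Import structures.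
From mathcomp Require Import all_boot all_order all_algebra.
From mathcomp Require Import all_classical all_reals.
From mathcomp Require Import topology normedtype derive.
From mathcomp Require Import ring.

Set Implicit Arguments.
Unset Strict Implicit.
Unset Printing Implicit Defensive.

Import Order.TTheory GRing.Theory Num.Theory.
Import numFieldNormedType.Exports.

Local Open Scope classical_set_scope.
Local Open Scope ring_scope.

(** The bi-f-tension field of a curve is the left-hand side of its
    Euler-Lagrange equation.  Expanded in the Frenet frame it has only four
    components, along [E 1], ..., [E 4]: the tension field is
    [f' E_1 + f k_1 E_2], and each of the two covariant derivatives that follow
    raises the highest frame index by one.  On the unit sphere
    [R(X, T) T = <T, T> X - <X, T> T], so the curvature term only adds
    [f^2 k_1 E_2].  The four components are the left-hand sides of the four
    equations, the third multiplied by [f] and the fourth by [f^2]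
    ([bitension_frenetE]); since the frame is orthonormal and [f > 0], the
    field vanishes if and only if the four equations hold.

    Three points need care.

    - The curvature tensor is given through the connection of the sphere
      applied to the extensions [q |-> z - <z, q> q].  At a point of the sphere
      and for tangent vectors, the double covariant derivative of such
      extensions is [- <z, x> y] and their bracket vanishes, which gives the
      expression above ([curvature_sphere]).

    - In dimension [n < 4] the frame is shorter than the expansion.  Completing
      it by zero fields beyond [E n] keeps every Frenet equation true, because
      the curvatures vanish from index [n] on ([cov_frenet_field1],
      [cov_frenet_field]); so one computation covers all dimensions.  The
      equations whose frame vector is missing then hold because
      the corresponding curvature vanishes on [I], and its derivatives with it.

    - The first curvature is a norm, so its differentiability has to be derived.
      It follows from [k_1 = <E_1', E_2>], the frame being smooth
      ([frenet_k1E]). *)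

(** * Bilinearity of the Euclidean product *)

Section DotAlgebra.
Context {R : realType} {m : nat}.
Implicit Types (u v w : 'rV[R]_m) (a : R).

Lemma dotC u v : dot u v = dot v u.
Proof. by apply: eq_bigr => i _; rewrite mulrC. Qed.

Lemma dotDl u v w : dot (u + v) w = dot u w + dot v w.
Proof.
by rewrite -big_split; apply: eq_bigr => i _; rewrite mxE mulrDl.
Qed.

Lemma dotZl a u v : dot (a *: u) v = a * dot u v.
Proof. by rewrite big_distrr /=; apply: eq_bigr => i _; rewrite mxE mulrA. Qed.

Lemma dot0l u : dot 0 u = 0.
Proof. by rewrite -(scale0r 0) dotZl mul0r. Qed.

Lemma dotNl u v : dot (- u) v = - dot u v.
Proof. by rewrite -scaleN1r dotZl mulN1r. Qed.

Lemma dotDr u v w : dot w (u + v) = dot w u + dot w v.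
Proof. by rewrite dotC dotDl !(dotC w). Qed.

Lemma dotZr a u v : dot u (a *: v) = a * dot u v.
Proof. by rewrite dotC dotZl dotC. Qed.

Lemma dot0r u : dot u 0 = 0.
Proof. by rewrite dotC dot0l. Qed.

Lemma dotNr u v : dot u (- v) = - dot u v.
Proof. by rewrite dotC dotNl dotC. Qed.

Definition dotE := (dotDl, dotDr, dotZl, dotZr, dotNl, dotNr, dot0l, dot0r).

End DotAlgebra.

(** * Product rules for row-vector valued maps *)

Section Leibniz.
Context {R : realType} {V : normedModType R}.
Implicit Types (x v : V).

(** Makes the product rules below consequences of the scalar ones, entry by
    entry. *)
Lemma is_derive_mxP m n (M : V -> 'M[R]_(m, n)) (dM : 'M[R]_(m, n)) x v :
  is_derive x v M dM <->
  forall i j, is_derive x v (fun y => M y i j) (dM i j).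
Proof.
split=> [[dMx <-] i j|dMx].
  apply: DeriveDef; first exact: (derivable_mxP M x v).1.
  by rewrite derive_mx // mxE.
have Mx : derivable M x v by apply/derivable_mxP => i j; case: (dMx i j).
apply: DeriveDef => //; rewrite derive_mx //; apply/matrixP => i j.
by rewrite mxE; case: (dMx i j).
Qed.

Lemma is_derive_scale_row m (a : V -> R) (F : V -> 'rV[R]_m) x v da dF :
  is_derive x v a da -> is_derive x v F dF ->
  is_derive x v (fun y => a y *: F y) (da *: F x + a x *: dF).
Proof.
move=> ax /is_derive_mxP Fx; apply/is_derive_mxP => i j.
have -> : (fun y => (a y *: F y) i j) = a * (fun y => F y i j).
  by apply/funext => y; rewrite mxE.
by apply: is_derive_eq; rewrite !mxE addrC; congr (_ + _); rewrite [LHS]mulrC.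
Qed.

Lemma is_derive_dot m (F G : V -> 'rV[R]_m) x v dF dG :
  is_derive x v F dF -> is_derive x v G dG ->
  is_derive x v (fun y => dot (F y) (G y)) (dot dF (G x) + dot (F x) dG).
Proof.
move=> /is_derive_mxP Fx /is_derive_mxP Gx.
have -> : (fun y => dot (F y) (G y)) =
    \sum_(i < m) ((fun y => F y 0 i) * (fun y => G y 0 i)).
  by apply/funext => y; rewrite fct_sumE.
apply: is_derive_eq; rewrite -big_split; apply: eq_bigr => i _ /=.
by rewrite addrC; congr (_ + _); rewrite [LHS]mulrC.
Qed.

Lemma is_derive_tangent_part n (c F : V -> 'rV[R]_n.+1) x v dc dF :
  is_derive x v c dc -> is_derive x v F dF ->
  is_derive x v (fun y => tangent_part (c y) (F y))
    (dF - ((dot dF (c x) + dot (F x) dc) *: c x + dot (F x) (c x) *: dc)).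
Proof.
move=> cx Fx; apply: is_deriveB.
exact: is_derive_scale_row (is_derive_dot _ _) _.
Qed.

End Leibniz.

(** * The curvature tensor of the unit sphere *)

Section TangentPart.
Context {R : realType} {n : nat}.
Implicit Types (p x y z : 'rV[R]_n.+1).

Lemma tangent_partD p x y :
  tangent_part p (x + y) = tangent_part p x + tangent_part p y.
Proof. by rewrite /tangent_part dotDl scalerDl opprD addrACA. Qed.

Lemma tangent_partZ p a x : tangent_part p (a *: x) = a *: tangent_part p x.
Proof. by rewrite /tangent_part dotZl scalerBr scalerA. Qed.

Lemma tangent_partN p x : tangent_part p (- x) = - tangent_part p x.
Proof. by rewrite -scaleN1r tangent_partZ scaleN1r. Qed.

Lemma tangent_part_id p x : dot x p = 0 -> tangent_part p x = x.
Proof. by rewrite /tangent_part => ->; rewrite scale0r subr0. Qed.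

Lemma tangent_part_normal p : sphere p -> tangent_part p p = 0.
Proof. by rewrite /tangent_part => ->; rewrite scale1r subrr. Qed.

Lemma is_derive_extend z p v :
  is_derive p v (extend z) (- (dot z v *: p + dot z p *: v)).
Proof.
apply: is_derive_eq.
  exact: is_derive_tangent_part (is_derive_id _ _) (is_derive_cst _ _ _).
by rewrite dot0l !add0r.
Qed.

Lemma nabla_extend y z p :
  nabla (extend y) (extend z) p =
  tangent_part p (- (dot z (extend y p) *: p + dot z p *: extend y p)).
Proof.
by rewrite /nabla; have [_ ->] := is_derive_extend z p (extend y p).
Qed.

(** Along [x], the inner field has, before its tangential projection, the
    derivative [- <z, x> y - <z, y> x] plus a multiple of [p].  The term in [x]
    is cancelled by the variation of the projection, whose base point moves
    along [x]; the outer projection removes the multiples of [p]. *)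
Lemma nabla_nabla_extend p x y z : sphere p ->
  dot x p = 0 -> dot y p = 0 -> dot z p = 0 ->
  nabla (extend x) (nabla (extend y) (extend z)) p = - dot z x *: y.
Proof.
move=> pp xp yp zp; rewrite /nabla -/(nabla (extend y) (extend z)).
have -> : nabla (extend y) (extend z) = fun q =>
    tangent_part q (- (dot z (extend y q) *: q + dot z q *: extend y q)).
  by apply/funext => q; rewrite nabla_extend.
have ext w : dot w p = 0 -> extend w p = w by exact: tangent_part_id.
rewrite (ext x) //.
have dy := is_derive_extend y p x; have id_p := is_derive_id p x.
have cst_z := is_derive_cst z p x.
have := is_derive_tangent_part id_p
  (is_deriveN (is_deriveD
    (is_derive_scale_row (is_derive_dot cst_z dy) id_p)
    (is_derive_scale_row (is_derive_dot cst_z id_p) dy))).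
move=> [_ ->]; rewrite /= (ext y) //.
rewrite !(dotE, tangent_partD, tangent_partN, tangent_partZ).
rewrite tangent_part_normal // !tangent_part_id //.
rewrite pp (dotC p x) xp yp zp; apply/rowP => i; rewrite !mxE; ring.
Qed.

(** Constant sectional curvature one.  The bracket of the extensions vanishes at
    [p]: both of its terms are [- <x, y> p]. *)
Lemma curvature_sphere p x y z : sphere p ->
  dot x p = 0 -> dot y p = 0 -> dot z p = 0 ->
  curvature_at p x y z = dot y z *: x - dot x z *: y.
Proof.
move=> pp xp yp zp; rewrite /curvature_at /curvature !nabla_nabla_extend //.
have bracket0 : bracket (extend x) (extend y) p = 0.
  rewrite /bracket.
  have [_ ->] := is_derive_extend y p (extend x p).
  have [_ ->] := is_derive_extend x p (extend y p).
  rewrite /extend !tangent_part_id // xp yp (dotC x y) !scale0r !addr0.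
  by rewrite subrr.
rewrite /nabla bracket0 derive0 /tangent_part dot0l scale0r !subr0.
by rewrite !(dotC z) !scaleNr opprK addrC.
Qed.

End TangentPart.

(** * Derivatives of maps known on an open set *)

Section LocalDerivatives.
Context {R : realType} {V : normedModType R}.
Variable I : set R.
Hypothesis openI : open I.
Implicit Types (F G : R -> V) (t : R).

Lemma is_derive1P F t d : is_derive t 1 F d -> derive1 F t = d.
Proof. by move=> [_ <-]; exact: derive1E. Qed.

Lemma derivable_is_derive1 F t :
  derivable F t 1 -> is_derive t 1 F (derive1 F t).
Proof. by move=> Ft; rewrite derive1E; exact: derivableP. Qed.

Lemma is_derive_eq_on F G t d : {in I, F =1 G} -> I t ->
  is_derive t 1 F d -> is_derive t 1 G d.
Proof.
move=> FG It; apply: near_eq_is_derive.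
have : \forall s \near t, I s by exact: open_nbhs_nbhs.
by apply: filterS => s Is; apply: FG; rewrite inE.
Qed.

Lemma derive1_eq_on F G t : {in I, F =1 G} -> I t ->
  derive1 F t = derive1 G t.
Proof.
move=> FG It; rewrite !derive1E; apply: near_eq_derive.
have : \forall s \near t, I s by exact: open_nbhs_nbhs.
by apply: filterS => s Is; apply: FG; rewrite inE.
Qed.

Lemma derive1_eq0_on F : {in I, F =1 cst 0} -> {in I, derive1 F =1 cst 0}.
Proof.
move=> F0 t /[1!inE] It.
by rewrite (derive1_eq_on F0 It) derive1_cst.
Qed.

Lemma smooth_is_derive F m t : smooth_on I F -> I t ->
  is_derive t 1 (derive1n m F) (derive1n m.+1 F t).
Proof. by move=> smF It; exact/derivable_is_derive1/smF. Qed.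

Lemma smooth_on_eq0 F : {in I, F =1 cst 0} -> smooth_on I F.
Proof.
move=> F0 m t It.
have Fm0 : {in I, derive1n m F =1 cst 0}.
  by elim: m => [|m IHm] //; exact: derive1_eq0_on.
suff [] : is_derive t 1 (derive1n m F) 0 by [].
by apply: (is_derive_eq_on _ It (is_derive_cst 0 t 1)) => s Is; rewrite Fm0.
Qed.

End LocalDerivatives.

(** * Covariant derivative along a curve *)

Section CovariantDerivative.
Context {R : realType} {n : nat}.
Variable I : set R.
Hypothesis openI : open I.
Implicit Types (c V W : R -> 'rV[R]_n.+1) (a : R -> R) (t : R).

Lemma cov_eq_on c V W t : {in I, V =1 W} -> I t -> cov c V t = cov c W t.
Proof. by move=> VW It; rewrite /cov (derive1_eq_on openI VW It). Qed.

Lemma covD c V W t : derivable V t 1 -> derivable W t 1 ->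
  cov c (fun s => V s + W s) t = cov c V t + cov c W t.
Proof.
move=> /derivable_is_derive1 Vt /derivable_is_derive1 Wt.
by rewrite /cov (is_derive1P (is_deriveD Vt Wt)) tangent_partD.
Qed.

(** Tangency is what keeps [V t] unprojected in the first term. *)
Lemma cov_scale c a V t da : is_derive t 1 a da -> derivable V t 1 ->
  dot (V t) (c t) = 0 ->
  cov c (fun s => a s *: V s) t = da *: V t + a t *: cov c V t.
Proof.
move=> a_t /derivable_is_derive1 Vt Vc.
rewrite /cov (is_derive1P (is_derive_scale_row a_t Vt)).
by rewrite tangent_partD !tangent_partZ (tangent_part_id Vc).
Qed.

End CovariantDerivative.

(** * The Frenet frame completed by zero *)

Section FrenetFields.
Context {R : realType} {n : nat}.
Variables (I : set R) (c : R -> 'rV[R]_n.+1).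
Variables (E : nat -> R -> 'rV[R]_n.+1) (k : nat -> R -> R).
Hypotheses (openI : open I) (n_gt0 : (0 < n)%N) (hE : frenet_frame I c E k).

(** The fields [E r] with [n < r] are unconstrained; replacing them by zero
    makes the Frenet equations hold at every positive index. *)
Definition frenet_field r : R -> 'rV[R]_n.+1 :=
  if (r <= n)%N then E r else cst 0.

Local Notation G := frenet_field.

Lemma frenet_field_smooth r : (0 < r)%N -> smooth_on I (G r).
Proof.
move=> r_gt0; rewrite /G; case: ifP => rn.
  by apply: frenet_smooth hE _ _; rewrite r_gt0.
exact: smooth_on_eq0.
Qed.

Lemma frenet_field_derivable r t : (0 < r)%N -> I t -> derivable (G r) t 1.
Proof. by move=> r_gt0 It; apply: (frenet_field_smooth r_gt0 (m := 0%N)). Qed.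

Lemma frenet_field_tangent r t : (0 < r)%N -> I t -> dot (G r t) (c t) = 0.
Proof.
move=> r_gt0 It; rewrite /G; case: ifP => rn; last exact: dot0l.
by apply: frenet_tangent hE _ _ _ It; rewrite r_gt0.
Qed.

Lemma dot_frenet_field r s t : (0 < r)%N -> (0 < s)%N -> I t ->
  dot (G r t) (G s t) = ((r == s) && (r <= n)%N)%:R.
Proof.
move=> r_gt0 s_gt0 It; rewrite /G.
case: (leqP r n) => rn; last by rewrite dot0l andbF.
rewrite andbT; case: (leqP s n) => sn; last first.
  by rewrite dot0r (ltn_eqF (leq_ltn_trans rn sn)).
by apply: (frenet_orthonormal hE); rewrite ?r_gt0 ?s_gt0.
Qed.

Lemma frenet_field1 t : I t -> G 1%N t = derive1 c t.
Proof. by move=> It; rewrite /G n_gt0 (frenet_first hE). Qed.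

Lemma cov_frenet_field1 t : I t -> cov c (G 1%N) t = k 1%N t *: G 2%N t.
Proof.
move=> It; rewrite /G n_gt0 (frenet_eq1 hE It).
by case: (leqP 2 n) => // n_lt2; rewrite (frenet_k_eq0 hE n_lt2 It) !scale0r.
Qed.

(** For [r.+1 = n] the missing last term is a multiple of a zero field; for
    [n < r.+1] the left-hand side is zero and so are [k r] and [k r.+1]. *)
Lemma cov_frenet_field r t : (0 < r)%N -> I t ->
  cov c (G r.+1) t = - k r t *: G r t + k r.+1 t *: G r.+2 t.
Proof.
move=> r_gt0 It; rewrite /G; case: (ltngtP r.+1 n) => [rn|nr|rn].
- rewrite (ltnW (ltnW rn)).
  by rewrite (frenet_eq hE) ?rn ?andbT.
- rewrite (frenet_k_eq0 hE nr It) (frenet_k_eq0 hE (leqW nr) It).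
  rewrite oppr0 !scale0r addr0 /cov derive1_cst.
  by rewrite /tangent_part dot0l scale0r subr0.
- rewrite -[X in (r <= X)%N]rn leqnSn scaler0 addr0.
  have n2 : (2 <= n)%N by rewrite -rn.
  by rewrite (congr1 E rn) (frenet_eqn hE n2 It) -(congr1 predn rn).
Qed.

Lemma frenet_curvature_smooth r : (1 < r)%N -> smooth_on I (k r).
Proof.
move=> r_gt1; case: (ltnP r n) => rn.
  by apply: frenet_k_smooth hE _ _; rewrite r_gt1.
apply: smooth_on_eq0 => // t /[1!inE] It; exact: frenet_k_eq0 hE _ _ rn It.
Qed.

(** Projecting [E_1'] on the tangent space does not change its product with the
    tangent vector [E_2].  If [n = 1] both sides are zero. *)
Lemma frenet_k1E t : I t -> k 1%N t = dot (derive1 (G 1%N) t) (G 2%N t).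
Proof.
move=> It.
have := cov_frenet_field1 It; move/(congr1 (dot^~ (G 2%N t))).
rewrite /cov /tangent_part !dotE dot_frenet_field // (dotC (c t)).
rewrite frenet_field_tangent // mulr0 subr0 => ->.
case: (leqP 2 n) => n2; first by rewrite mulr1.
by rewrite (frenet_k_eq0 hE n2 It) mul0r.
Qed.

Lemma frenet_k1_derivable t : I t -> derivable (k 1%N) t 1.
Proof.
move=> It.
have /= D1 := smooth_is_derive 1%N (frenet_field_smooth (isT : 0 < 1)%N) It.
have /= D2 := smooth_is_derive 0%N (frenet_field_smooth (isT : 0 < 2)%N) It.
have k1E : {in I, (fun s => dot (derive1 (G 1%N) s) (G 2%N s)) =1 k 1%N}.
  by move=> s /[1!inE] Is; rewrite frenet_k1E.
by case: (is_derive_eq_on openI k1E It (is_derive_dot D1 D2)).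
Qed.

Lemma frenet_k1_derivable2 t : I t -> derivable (derive1 (k 1%N)) t 1.
Proof.
move=> It.
have sm1 := frenet_field_smooth (isT : 0 < 1)%N.
have sm2 := frenet_field_smooth (isT : 0 < 2)%N.
have D s (Is : I s) := is_derive_dot
  (smooth_is_derive 1%N sm1 Is) (smooth_is_derive 0%N sm2 Is).
have D2 := is_deriveD
  (is_derive_dot (smooth_is_derive 2%N sm1 It) (smooth_is_derive 0%N sm2 It))
  (is_derive_dot (smooth_is_derive 1%N sm1 It) (smooth_is_derive 1%N sm2 It)).
apply: (@ex_derive _ _ _ _ _ _ _ (is_derive_eq_on openI _ It D2)).
move=> s /[1!inE] Is; apply/esym/is_derive1P.
apply: (is_derive_eq_on openI _ Is (D s Is)) => u /[1!inE] Iu.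
by rewrite frenet_k1E.
Qed.

(** Used twice: with coefficients [f', f k_1, 0] for the tension field, and then
    for [f] times the covariant derivative so obtained.  In both cases the
    expansion stops at [E_3] before differentiation. *)
Lemma cov_frenet_combination (a1 a2 a3 : R -> R) (d1 d2 d3 : R) t : I t ->
  is_derive t 1 a1 d1 -> is_derive t 1 a2 d2 -> is_derive t 1 a3 d3 ->
  cov c (fun s => a1 s *: G 1%N s + a2 s *: G 2%N s + a3 s *: G 3%N s) t =
    (d1 - k 1%N t * a2 t) *: G 1%N t
  + (d2 + k 1%N t * a1 t - k 2%N t * a3 t) *: G 2%N t
  + (d3 + k 2%N t * a2 t) *: G 3%N t
  + (k 3%N t * a3 t) *: G 4%N t.
Proof.
move=> It D1 D2 D3.
have der r (a : R -> R) (d : R) : (0 < r)%N -> is_derive t 1 a d ->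
    derivable (fun s => a s *: G r s) t 1.
  move=> r_gt0 ad; have Gt := frenet_field_derivable r_gt0 It.
  by case: (is_derive_scale_row ad (derivable_is_derive1 Gt)).
have der1 := der 1%N _ _ isT D1; have der2 := der 2%N _ _ isT D2.
have der3 := der 3%N _ _ isT D3.
have der12 := derivableD der1 der2.
rewrite (covD c der12 der3) (covD c der1 der2).
have covaG r a d (r_gt0 : (0 < r)%N) (ad : is_derive t 1 a d) :=
  cov_scale ad (frenet_field_derivable r_gt0 It)
    (frenet_field_tangent r_gt0 It).
rewrite (covaG _ _ _ _ D1) // (covaG _ _ _ _ D2) // (covaG _ _ _ _ D3) //.
rewrite cov_frenet_field1 // !cov_frenet_field //.
apply/rowP => i; rewrite !mxE; ring.
Qed.

(** Only the components along the actual frame are determined, hence the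
    restriction to [r <= n]. *)
Lemma frenet_combination_eq0 (a : nat -> R) t : I t ->
  a 1%N *: G 1%N t + a 2%N *: G 2%N t + a 3%N *: G 3%N t
    + a 4%N *: G 4%N t = 0 <->
  forall r, (0 < r <= 4)%N -> (r <= n)%N -> a r = 0.
Proof.
move=> It; split=> [comb0 r /andP[r_gt0 r4] rn|a0].
  have := congr1 (dot^~ (G r t)) comb0; rewrite !dotE !dot_frenet_field //.
  case: r r_gt0 r4 rn => [|[|[|[|[|r]]]]] //= _ _ ->;
    by rewrite ?mulr1 ?mulr0 ?add0r ?addr0.
have aG r : (0 < r <= 4)%N -> a r *: G r t = 0.
  move=> r4; rewrite /G; case: ifP => rn; last exact: scaler0.
  by rewrite a0 // scale0r.
by rewrite !aG // !addr0.
Qed.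

Lemma frenet_curvature_eq0 r : (n <= r)%N -> {in I, k r =1 cst 0}.
Proof. by move=> nr t /[1!inE]; exact: frenet_k_eq0 hE _ _ nr. Qed.

(** The Frenet components of the bi-f-tension field.  The intermediate field is
    [f (f'' - k_1^2 f) E_1 + f (2 f' k_1 + f k_1') E_2 + f^2 k_1 k_2 E_3], and
    the curvature term contributes [f^2 k_1] along [E_2]. *)
Lemma bitension_frenetE (f : R -> R) t :
    (forall s, I s -> sphere (c s)) -> smooth_on I f -> I t ->
  cov c (fun s => f s *: cov c (tension f c) s) t
  + f t *: curvature_at (c t) (tension f c t) (derive1 c t) (derive1 c t) =
    (- 3 * k 1%N t * derive1 (k 1%N) t * f t ^+ 2
     - 4 * k 1%N t ^+ 2 * f t * derive1 f t
     + f t * derive1n 3 f t + derive1 f t * derive1n 2 f t) *: G 1%N t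
  + (- k 1%N t ^+ 3 * f t ^+ 2 - k 1%N t * k 2%N t ^+ 2 * f t ^+ 2
     + derive1n 2 (k 1%N) t * f t ^+ 2 + k 1%N t * f t ^+ 2
     + 4 * derive1 (k 1%N) t * f t * derive1 f t
     + 3 * k 1%N t * f t * derive1n 2 f t
     + 2 * k 1%N t * derive1 f t ^+ 2) *: G 2%N t
  + (f t * (2 * derive1 (k 1%N) t * k 2%N t * f t
     + k 1%N t * derive1 (k 2%N) t * f t
     + 4 * k 1%N t * k 2%N t * derive1 f t)) *: G 3%N t
  + (f t ^+ 2 * (k 1%N t * k 2%N t * k 3%N t)) *: G 4%N t.
Proof.
move=> sphc smf It.
(* The zero coefficient gives the three-term shape of the combination lemma. *)
have tensionE : {in I, tension f c =1 fun s =>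
    derive1 f s *: G 1%N s + (f s * k 1%N s) *: G 2%N s + 0 *: G 3%N s}.
  move=> s /[1!inE] Is; have covT : cov c (derive1 c) s = k 1%N s *: G 2%N s.
    rewrite -(cov_frenet_field1 Is).
    apply: (cov_eq_on openI _ _ Is) => u /[1!inE] Iu.
    by rewrite (frenet_field1 Iu).
  by rewrite /tension covT (frenet_field1 Is) scale0r addr0 addrC scalerA.
have Dk s (Is : I s) := derivable_is_derive1 (frenet_k1_derivable Is).
have Dk2 s (Is : I s) := derivable_is_derive1 (frenet_k1_derivable2 Is).
have Dk' s (Is : I s) : is_derive s 1 (k 2%N) (derive1 (k 2%N) s) :=
  smooth_is_derive 0%N (frenet_curvature_smooth (isT : 1 < 2)%N) Is.
have Df s (Is : I s) : is_derive s 1 f (derive1 f s) :=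
  smooth_is_derive 0%N smf Is.
have Df1 s (Is : I s) : is_derive s 1 (derive1 f) (derive1n 2 f s) :=
  smooth_is_derive 1%N smf Is.
have Df2 s (Is : I s) : is_derive s 1 (derive1n 2 f) (derive1n 3 f s) :=
  smooth_is_derive 2%N smf Is.
have covE : {in I, (fun s => f s *: cov c (tension f c) s) =1
    fun s => (f s * (derive1n 2 f s - k 1%N s * (f s * k 1%N s))) *: G 1%N s
      + (f s * (2 * (derive1 f s * k 1%N s) + f s * derive1 (k 1%N) s))
        *: G 2%N s
      + (f s * (f s * (k 1%N s * k 2%N s))) *: G 3%N s}.
  move=> s /[1!inE] Is.
  rewrite (cov_eq_on openI c tensionE Is).
  rewrite (cov_frenet_combination Is (Df1 s Is)
    (is_deriveM (Df s Is) (Dk s Is)) (is_derive_cst 0 s 1)) /=.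
  apply/rowP => i; rewrite !mxE !fctE /GRing.scale /=; ring.
rewrite (cov_eq_on openI c covE It).
have DA := is_deriveM (Df t It) (is_deriveB (Df2 t It)
  (is_deriveM (Dk t It) (is_deriveM (Df t It) (Dk t It)))).
have DB := is_deriveM (Df t It) (is_deriveD
  (is_deriveM (is_derive_cst (2 : R) t 1) (is_deriveM (Df1 t It) (Dk t It)))
  (is_deriveM (Df t It) (Dk2 t It))).
have DC := is_deriveM (Df t It)
  (is_deriveM (Df t It) (is_deriveM (Dk t It) (Dk' t It))).
rewrite (cov_frenet_combination It DA DB DC).
have tanG r : (0 < r)%N -> dot (G r t) (c t) = 0.
  by move=> r_gt0; exact: frenet_field_tangent.
rewrite curvature_sphere -?frenet_field1 ?tanG //; last 2 first.
- exact: sphc.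
- by rewrite tensionE ?inE // !dotE !tanG // !mulr0 !addr0.
rewrite tensionE ?inE // !dotE !dot_frenet_field //= n_gt0 /=.
rewrite !fctE /GRing.scale /=.
(* With the derivatives turned into variables, comparing the atoms of the
   polynomial identity does not unfold them. *)
move: (derive1 (derive1 (derive1 f)) t) (derive1 (derive1 f) t) (derive1 f t).
move: (derive1 (derive1 (k 1%N)) t) (derive1 (k 1%N) t) (derive1 (k 2%N) t).
move: (f t) (k 1%N t) (k 2%N t) (k 3%N t) (G 1%N t) (G 2%N t) (G 3%N t).
move=> f0 k1 k2 k3 G1 G2 G3 k1'' k1' k2' f3 f2 f1; move: (G 4%N t) => G4.
by apply/rowP => i; rewrite !mxE; ring.
Qed.

End FrenetFields.

(** * Characterization of bi-f-harmonic curves *)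

Theorem theorem3p15 (R : realType) (n : nat) (hn : (0 < n)%N)
    (I : set R) (hI : open_interval I)
    (gamma : R -> 'rV[R]_n.+1) (hgamma : unit_speed_curve I gamma)
    (E : nat -> R -> 'rV[R]_n.+1) (k : nat -> R -> R)
    (hE : frenet_frame I gamma E k)
    (f : R -> R) (hf : smooth_on I f)
    (hf0 : forall t, I t -> 0 < f t) :
  bi_f_harmonic I f gamma <->
  (forall t, I t ->
   [/\ - 3 * k 1%N t * derive1 (k 1%N) t * f t ^+ 2
       - 4 * k 1%N t ^+ 2 * f t * derive1 f t
       + f t * derive1n 3 f t + derive1 f t * derive1n 2 f t = 0,
       - k 1%N t ^+ 3 * f t ^+ 2 - k 1%N t * k 2%N t ^+ 2 * f t ^+ 2
       + derive1n 2 (k 1%N) t * f t ^+ 2 + k 1%N t * f t ^+ 2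
       + 4 * derive1 (k 1%N) t * f t * derive1 f t
       + 3 * k 1%N t * f t * derive1n 2 f t + 2 * k 1%N t * derive1 f t ^+ 2 = 0,
       2 * derive1 (k 1%N) t * k 2%N t * f t + k 1%N t * derive1 (k 2%N) t * f t
       + 4 * k 1%N t * k 2%N t * derive1 f t = 0
     & k 1%N t * k 2%N t * k 3%N t = 0]).
Proof.
case: hI => openI _; case: hgamma => _ sphc _.
have bitensionE t (It : I t) := bitension_frenetE openI hn hE sphc hf It.
have comb t (It : I t) a := frenet_combination_eq0 hE a It.
have k0 r t (nr : (n <= r)%N) (It : I t) : k r t = 0 := frenet_k_eq0 hE nr It.
have dk0 r t (nr : (n <= r)%N) (It : I t) : derive1 (k r) t = 0.
  by apply: (derive1_eq0_on openI (frenet_curvature_eq0 hE nr)); rewrite inE.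
have ddk0 r t (nr : (n <= r)%N) (It : I t) : derive1n 2 (k r) t = 0.
  have dk0I := derive1_eq0_on openI (frenet_curvature_eq0 hE nr).
  by apply: (derive1_eq0_on openI dk0I); rewrite inE.
split=> [harm t It|eqs t It]; last first.
  rewrite (bitensionE t It).
  set e1 := (X in X *: _ + _ + _ + _); set e2 := (X in _ + X *: _ + _ + _).
  set e3 := (X in _ + _ + (_ * X) *: _ + _).
  set e4 := (X in _ + _ + _ + (_ * X) *: _).
  have [-> -> -> ->] : [/\ e1 = 0, e2 = 0, e3 = 0 & e4 = 0] := eqs t It.
  by rewrite !mulr0 !scale0r !addr0.
have := harm t It; rewrite (bitensionE t It).
set e1 := (X in X *: _ + _ + _ + _); set e2 := (X in _ + X *: _ + _ + _).
set e3 := (X in _ + _ + (_ * X) *: _ + _).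
set e4 := (X in _ + _ + _ + (_ * X) *: _).
move=> comb0.
(* Frame indices start at 1, so position 0 of the list is a filler. *)
pose a := nth 0 [:: 0; e1; e2; f t * e3; f t ^+ 2 * e4].
have coef0 := (comb t It a).1 comb0.
have ft0 : f t != 0 by rewrite gt_eqF ?hf0.
split.
- exact: (coef0 1%N).
(* Each remaining equation follows from the component along [E r] when [r <= n],
   and otherwise from [k r.-1] being zero on [I]. *)
- case: (leqP 2 n) => n2; first exact: (coef0 2%N).
  by rewrite (k0 1%N) // (dk0 1%N) // (ddk0 1%N) //; ring.
- case: (leqP 3 n) => n3.
    by have /eqP := coef0 3%N isT n3; rewrite mulf_eq0 (negPf ft0) => /eqP.
  by rewrite (k0 2%N) // (dk0 2%N) //; ring.
- case: (leqP 4 n) => n4.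
    have /eqP := coef0 4%N isT n4.
    by rewrite mulf_eq0 expf_eq0 (negPf ft0) => /eqP.
  by rewrite (k0 3%N) // mulr0.
Qed.
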